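(* Let $T$ be a tree. Then the cover ideal $J(T)$ is quasi-equigenerated if and only if every vertex of $T$ of degree at least $2$ is adjacent to a leaf.
   Context: All graphs are finite and simple (no loops or multiple edges). A tree is a graph not containing any induced cycle. A leaf is a vertex of degree $1$. For a graph $G$ with vertices $x_1,\dots,x_n$ (identified with the variables of $R=k[x_1,\dots,x_n]$, $k$ a field) and edge set $E$, the cover ideal is $J(G)=\bigcap_{\{x_i,x_j\}\in E}(x_i,x_j)\subseteq R$; it is a squarefree monomial ideal. A monomial ideal $I$ of $R$ with minimal monomial generators $f_1,\dots,f_t$, $f_j=\prod_{i=1}^n x_i^{c_{ij}}$, is quasi-equigenerated if there is $\alpha=(a_1,\dots,a_n)$ with all $a_i$ positive integers such that $d_\alpha(f_j):=\sum_{i=1}^n a_i c_{ij}$ is the same for all $j$. *)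

(* Defs.v *)
From mathcomp Require Import all_boot all_order all_algebra.
From mathcomp Require Import mpoly.

Set Implicit Arguments.
Unset Strict Implicit.
Unset Printing Implicit Defensive.

Import GRing.Theory.
Local Open Scope ring_scope.

(* A simple graph on the vertex set 'I_n is a symmetric irreflexive relation  *)
(* e : rel 'I_n.                                                              *)

Section Graphs.
Variables (n : nat) (e : rel 'I_n).

Definition degree (v : 'I_n) : nat := #|[set w | e v w]|.

Definition leaf (v : 'I_n) : bool := degree v == 1%N.

(* The subgraph induced on the vertices of c is exactly the cycle that visits *)
(* them in the order given by c.                                              *)
Definition induced_cycle (c : seq 'I_n) : Prop :=
  [/\ (2 < size c)%N, uniq c &
      {in c &, forall u v, e u v = (v == next c u) || (u == next c v)}].

(* Connectedness is not required.                                             *)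
Definition tree : Prop := forall c : seq 'I_n, ~ induced_cycle c.

End Graphs.

Section Ideals.
Variables (n : nat) (k : fieldType).
Implicit Types (I J : {mpoly k[n]} -> Prop) (s : seq 'X_{1..n}).

Definition ideal_gen (g : seq {mpoly k[n]}) (p : {mpoly k[n]}) : Prop :=
  exists q : 'I_(size g) -> {mpoly k[n]}, p = \sum_(i < size g) q i * g`_i.

Definition same_ideal I J : Prop := forall p, I p <-> J p.

Definition monomial_ideal s : {mpoly k[n]} -> Prop :=
  ideal_gen [seq 'X_[m] | m <- s].

Definition minimal_generators s I : Prop :=
  [/\ uniq s, same_ideal (monomial_ideal s) I &
      forall s', {subset s' <= s} -> same_ideal (monomial_ideal s') I ->
        {subset s <= s'}].

Definition wdeg (a : 'I_n -> nat) (m : 'X_{1..n}) : nat :=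
  (\sum_(i < n) a i * m i)%N.

(* The minimal monomial generating set of a monomial ideal is unique, so the  *)
(* existential on s only says that I is a monomial ideal and names that set.  *)
Definition quasi_equigenerated I : Prop :=
  exists s, minimal_generators s I /\
    exists a : 'I_n -> nat,
      (forall i, 0 < a i)%N /\ {in s &, forall f g, wdeg a f = wdeg a g}.

Definition cover_ideal (e : rel 'I_n) (p : {mpoly k[n]}) : Prop :=
  forall i j, e i j -> ideal_gen [:: 'X_i; 'X_j] p.

End Ideals.

Arguments cover_ideal [n] k e p.

(* Main.v *)
(* The minimal generators of J(T) are the indicators of the complements of the
   maximal independent sets, so J(T) is quasi-equigenerated exactly when some
   positive weight a is constant on maximal independent sets.
   Suppose v has two neighbours u1, u2 but no leaf neighbour.  Some maximal
   independent set M contains v and dominates each neighbour of v from M - v;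
   let G be one containing u1 and u2.  In a forest u1 and u2 lie in different
   components of T - v; exchanging M - v and G on the component of u1 yields two
   maximal independent sets of total weight a(G) + a(M) - a(v), so a(v) = 0.
   Conversely a minimal cover contains exactly one end of each edge at a leaf,
   so counting these edges gives a constant weight, positive at every
   non-isolated vertex when each vertex of degree at least 2 has a leaf
   neighbour. *)
Require Import Defs.
From mathcomp Require Import all_boot all_order all_algebra.
From mathcomp Require Import mpoly zify.

Set Implicit Arguments.
Unset Strict Implicit.
Unset Printing Implicit Defensive.

(** * Independent sets in forests and the exchange argument *)

Section Graphs.
Variables (n : nat) (e : rel 'I_n).
Hypotheses (e_sym : ssrbool.symmetric e) (e_irr : irreflexive e).
Implicit Types (u v w x y : 'I_n) (M S : {set 'I_n}).

(* A chord splits a cycle into two shorter ones, so a shortest cycle is induced. *)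
Lemma tree_cycle_size (e_tree : tree e) (c : seq 'I_n) :
  uniq c -> cycle e c -> size c <= 2.
Proof.
have [m] := ubnP (size c); elim: m c => // m IHm c.
rewrite ltnS => le_cm Uc Cc; rewrite leqNgt; apply/negP => c_gt2.
apply: (e_tree c); split=> // u v uc vc.
apply/idP/orP => [euv | [/eqP-> | /eqP->]]; last first.
- by rewrite e_sym; apply: next_cycle.
- exact: next_cycle.
apply/orP; apply: contraT; rewrite negb_or => /andP[v_nu u_nv].
case: (rot_to uc) => i c' def_c.
have vu : v != u by apply: contraTneq euv => ->; rewrite e_irr.
have: v \in u :: c' by rewrite -def_c mem_rot.
rewrite inE (negPf vu) /= => vc'.
move: v_nu u_nv; rewrite -!(next_rot i Uc); move: Uc Cc le_cm; rewrite -(size_rot i).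
rewrite -(rot_uniq i) -(rot_cycle i) def_c.
case/splitPr: vc' => p1 p2 {def_c} Uc' Cc' le_cm v_nu u_nv.
(* Were [p1] or [p2] empty, [u] and [v] would be consecutive on the cycle. *)
have p1_n0 : 0 < size p1.
  by case: p1 v_nu {Uc' Cc' le_cm u_nv} => //=; rewrite eqxx eqxx.
have p2_n0 : 0 < size p2.
  case: p2 Uc' u_nv {Cc' le_cm v_nu} => // Uc'.
  rewrite next_nth inE mem_cat inE eqxx !orbT /= [X in if X then _ else _]eq_sym (negPf vu).
  rewrite nth_default ?eqxx // size_cat addn1 index_cat.
  move: Uc'; rewrite /= cat_uniq /= orbF => /and3P[_ _ /andP[/negPf-> _]].
  by rewrite /= eqxx addn0.
(* The chord closes [u, p1, v] into a cycle, shorter as [p2] is nonempty, yet with at least 3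
   vertices. *)
suff: size (u :: rcons p1 v) <= 2 by rewrite /= size_rcons !ltnS leqNgt p1_n0.
apply: IHm.
- by move: le_cm p2_n0; rewrite /= size_rcons size_cat /=; lia.
- by move: Uc'; rewrite -cat_rcons -cat_cons cat_uniq => /andP[].
- move: Cc'; rewrite /= rcons_cat -!cats1 /= !cat_path /= => /andP[-> /=].
  by case/andP=> -> _; rewrite cats1 last_rcons e_sym euv.
Qed.

Definition adj_avoiding v : rel 'I_n := [rel x y | [&& e x y, x != v & y != v]].

Lemma adj_avoiding_sym v : connect_sym (adj_avoiding v).
Proof. by apply: sym_connect_sym => x y; rewrite /adj_avoiding /= e_sym [(x != v) && _]andbC. Qed.

(** A path from [u1] to [u2] avoiding [v], closed up through [v], would be a cycle with at least 3
    vertices. *)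
Lemma tree_neighbors_disconnected (e_tree : tree e) v u1 u2 :
  e v u1 -> e v u2 -> connect (adj_avoiding v) u1 u2 -> u1 = u2.
Proof.
move=> vu1 vu2 /connectP[q pth_q def_u2].
case/shortenP: pth_q def_u2 => p pth_p Up _ def_u2.
apply: contraTeq (isT) => u12.
have p_n0: 0 < size p by case: p def_u2 {pth_p Up} u12 => //= ->; rewrite eqxx.
suff: size (v :: u1 :: p) <= 2 by rewrite /= !ltnS leqNgt p_n0.
have nvu1 : u1 != v by apply: contraTneq vu1 => ->; rewrite e_irr.
apply: tree_cycle_size => //.
  rewrite /= in Up *; rewrite Up andbT inE negb_or eq_sym nvu1 /=.
  elim: p (u1) nvu1 pth_p {Up def_u2 p_n0 vu1 u12} => //= y p IHp x xv.
  by case/andP=> /and3P[_ _ yv] /(IHp _ yv); rewrite inE negb_or eq_sym yv.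
rewrite /= vu1 rcons_path -def_u2 e_sym vu2 andbT.
by apply: sub_path pth_p => x y /and3P[].
Qed.

Definition indep S := [forall x in S, forall y in S, ~~ e x y].

Lemma indepP S : reflect {in S &, forall x y, ~~ e x y} (indep S).
Proof.
apply: (iffP forall_inP) => [H x y xS yS | H x xS].
  exact: (forall_inP (H x xS)).
by apply/forall_inP => y yS; apply: H.
Qed.

Lemma max_indepP M :
  reflect (indep M /\ forall x, x \notin M -> exists2 y, y \in M & e x y)
          (maxset indep M).
Proof.
apply: (iffP maxsetP) => -[/[dup] indM /indepP iM maxM]; split=> //; last first.
  move=> S /indepP iS MS; apply/eqP; rewrite eqEsubset MS andbT.
  apply/subsetP => x xS; apply: contraT => /maxM[y yM exy].
  by rewrite -(negPf (iS x y xS (subsetP MS y yM))) exy.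
move=> x xM.
apply/exists_inP; apply: contraNT xM; rewrite negb_exists => /forallP nxM.
suff <-: x |: M = M by rewrite setU11.
apply: maxM (subsetU1 _ _); apply/indepP.
have xMn y : y \in M -> ~~ e x y by move=> yM; have := nxM y; rewrite yM.
move=> y z; rewrite !inE => /orP[/eqP->|yM] /orP[/eqP->|zM].
- by rewrite e_irr.
- exact: xMn.
- by rewrite e_sym xMn.
- exact: iM.
Qed.

Lemma max_indep_exists S : indep S -> exists2 M, maxset indep M & S \subset M.
Proof. by case/maxset_exists => M; exists M. Qed.

(** Each neighbour of [v], not being a leaf, has a second neighbour. These chosen vertices form with
    [v] an independent set, and any maximal one containing it will do. *)
Lemma tree_dominating_indep (e_tree : tree e) v :
  (forall w, e v w -> ~~ leaf e w) ->
  exists M, [/\ maxset indep M, v \in M &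
    forall u, e v u -> exists2 w, w \in M :\ v & e u w].
Proof.
move=> nleaf.
(* The [w u] lie in distinct components of the forest deprived of [v], so they
   are pairwise non-adjacent. *)
pose w u := odflt v [pick x | e u x && (x != v)].
(* The default [v] is never reached here: a neighbour of [v] adjacent to nothing else would be a
   leaf. *)
have wP u : e v u -> e u (w u) && (w u != v).
  move=> evu; rewrite /w; case: pickP => //= noW.
  case/negP: (nleaf u evu); apply/cards1P; exists v; apply/setP => x.
  rewrite !inE; apply/idP/eqP => [eux|->]; last by rewrite e_sym.
  by apply/eqP; have := noW x; rewrite eux => /negbFE.
have conn_w u : e v u -> connect (adj_avoiding v) u (w u).
  move=> evu; have /andP[euw wv] := wP u evu; apply: connect1.
  rewrite /adj_avoiding /= euw wv andbT; apply: contraTneq evu => ->; by rewrite e_irr.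
have nvw u : e v u -> ~~ e v (w u).
  move=> evu; apply/negP => evw; have /andP[euw _] := wP u evu.
  move: euw; rewrite -(tree_neighbors_disconnected e_tree evu evw (conn_w u evu)).
  by rewrite e_irr.
have indW : indep (v |: [set w u | u in [set u | e v u]]).
  apply/indepP => x y; rewrite !inE => /orP[/eqP->|/imsetP[u]].
    case/orP=> [/eqP->|/imsetP[u]]; first by rewrite e_irr.
    by rewrite inE => evu ->; apply: nvw.
  rewrite inE => evu ->; case/orP=> [/eqP->|/imsetP[u']].
    by rewrite e_sym; apply: nvw.
  rewrite inE => evu' ->; apply/negP => eww.
  have /andP[_ wv] := wP u evu; have /andP[_ wv'] := wP u' evu'.
  have uu' : u = u'.
    apply: (tree_neighbors_disconnected e_tree evu evu').
    apply: connect_trans (conn_w u evu) _; rewrite adj_avoiding_sym.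
    apply: connect_trans (conn_w u' evu') _; rewrite adj_avoiding_sym.
    by apply: connect1; rewrite /adj_avoiding /= eww wv wv'.
  by move: eww; rewrite uu' e_irr.
have [M maxM /subsetP WM] := max_indep_exists indW.
exists M; split=> // [|u evu]; first by apply: WM; rewrite setU11.
have /andP[euw wv] := wP u evu; exists (w u) => //; rewrite !inE wv /=.
by apply: WM; rewrite setU1r // imset_f // inE.
Qed.

(* Away from [v], [A] is a union of components of the graph deprived of [v]. *)
Lemma max_indep_glue v u M G (A : {set 'I_n}) :
  {in predC1 v &, forall x y, e x y -> (x \in A) = (y \in A)} ->
  maxset indep M -> v \in M ->
  (forall x, e v x -> exists2 y, y \in M :\ v & e x y) ->
  maxset indep G -> v \notin G -> e v u -> u \in G -> u \in A ->
  maxset indep (G :&: A :|: (M :\ v) :\: A).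
Proof.
move=> closA /max_indepP[/indepP iM domM] vM domN /max_indepP[/indepP iG domG].
move=> vG evu uG uA; apply/max_indepP; split.
  have nv x : x \in G :&: A :|: (M :\ v) :\: A -> x != v.
    by rewrite !inE => /orP[/andP[xG _]|/and3P[]//]; apply: contraNneq vG => <-.
  apply/indepP => x y xN yN; apply/negP => exy.
  have := closA x y (nv x xN) (nv y yN) exy; move: xN yN exy; rewrite !inE.
  case: (x \in A); case: (y \in A); rewrite ?andbT ?andbF ?orbF //=.
    by move=> xG yG exy; rewrite (negPf (iG _ _ xG yG)) in exy.
  by move=> /andP[_ xM] /andP[_ yM] exy; rewrite (negPf (iM _ _ xM yM)) in exy.
(* The vertex [v] is dominated by [u]; any other [x] is dominated from its own side of [A]. *)
move=> x; have [-> _|xv] := eqVneq x v; first by exists u; rewrite // !inE uG uA.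
rewrite !inE; case: (boolP (x \in A)) => xA; rewrite ?andbT ?andbF ?orbF /= ?xv /=.
  move=> /domG[y yG exy]; have yv : y != v by apply: contraNneq vG => <-.
  by exists y; rewrite // !inE yG -(closA x y) // xA.
move=> xM; suff [y /setD1P[yv yM] exy]: exists2 y, y \in M :\ v & e x y.
  by exists y; rewrite // !inE yv yM -(closA x y) // xA orbT.
(* If [v] is the dominator of [x] in [M], then [x] is a neighbour of [v] and [domN] gives a
   substitute. *)
have [y yM exy] := domM x xM; have [yv|yv] := eqVneq y v.
  by apply: domN; rewrite e_sym -yv.
by exists y; rewrite // !inE yv.
Qed.

Lemma tree_constant_weight_leaf (e_tree : tree e) (a : 'I_n -> nat) v :
  (forall i, 0 < a i) ->
  (forall S S', maxset indep S -> maxset indep S' ->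
     \sum_(i in S) a i = \sum_(i in S') a i) ->
  2 <= degree e v -> exists w, e v w /\ leaf e w.
Proof.
move=> a_gt0 wt_eq dv.
have [/exists_inP[w evw lw]|/exists_inPn noleaf] := boolP [exists w in e v, leaf e w].
  by exists w.
have [|M [maxM vM domN]] := tree_dominating_indep e_tree (v := v).
  by move=> w evw; apply: noleaf.
case/card_gt1P: dv => u1 [u2 [+ + u12]]; rewrite !inE => vu1 vu2.
have ind12 : indep [set u1; u2].
  have n12 : ~~ e u1 u2.
    apply: contra u12 => e12; apply/eqP.
    apply: (tree_neighbors_disconnected e_tree vu1 vu2); apply: connect1.
    rewrite /adj_avoiding /= e12 /=; apply/andP; split.
      by apply: contraTneq vu1 => ->; rewrite e_irr.
    by apply: contraTneq vu2 => ->; rewrite e_irr.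
  apply/indepP => x y; rewrite !inE => /orP[]/eqP-> /orP[]/eqP->; rewrite ?e_irr //.
  by rewrite e_sym.
have [G maxG /subsetP G12] := max_indep_exists ind12.
have u1G : u1 \in G by apply: G12; rewrite set21.
have u2G : u2 \in G by apply: G12; rewrite set22.
have vG : v \notin G.
  have [/indepP iG _] := max_indepP _ maxG.
  by apply/negP => vG; have := iG v u1 vG u1G; rewrite vu1.
pose A := [set x | connect (adj_avoiding v) u1 x].
have closA : {in predC1 v &, forall x y, e x y -> (x \in A) = (y \in A)}.
  move=> x y; rewrite !inE => xv yv exy.
  apply: (same_connect_r (@adj_avoiding_sym v)); apply: connect1.
  by rewrite /adj_avoiding /= exy xv yv.
have u1A : u1 \in A by rewrite inE connect0.
have u2A : u2 \notin A.
  rewrite inE; apply: contra u12 => c12; apply/eqP.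
  exact: (tree_neighbors_disconnected e_tree vu1 vu2 c12).
have closA' : {in predC1 v &, forall x y, e x y -> (x \in ~: A) = (y \in ~: A)}.
  by move=> x y xv yv exy; rewrite !in_setC (closA x y).
(* The two exchanges lose [v] but keep it dominated, by [u1] in the first and by [u2] in the
   second. *)
have max1 := max_indep_glue closA maxM vM domN maxG vG vu1 u1G u1A.
have max2 : maxset indep (G :&: ~: A :|: (M :\ v) :\: ~: A).
  by apply: max_indep_glue vu2 u2G _ => //; rewrite inE.
have := a_gt0 v; rewrite lt0n; case/eqP.
have e1 := wt_eq _ _ max1 maxM; have e2 := wt_eq _ _ max2 maxG.
have glueE (B : {set 'I_n}) :
    \sum_(i in G :&: B :|: (M :\ v) :\: B) a i =
    \sum_(i in G :&: B) a i + \sum_(i in (M :\ v) :\: B) a i.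
  rewrite -bigU; first by apply: eq_bigl => i; rewrite !inE.
  rewrite -setI_eq0; apply/eqP/setP => x; rewrite !inE.
  by case: (x \in B); rewrite /= ?andbF.
(* After cancellation, [e1] says that [G] outweighs [M :\ v] on [A] by exactly [a v], and [e2] that
   they weigh the same there. *)
rewrite glueE (big_setD1 v vM) /= (big_setID A (A := M :\ v)) /= in e1.
rewrite glueE -setDE [(M :\ v) :\: ~: A]setDE setCK (big_setID A (A := G)) /= in e2.
rewrite addnA in e1; move/addIn: e1 => e1.
rewrite addnC in e2; move/addIn: e2 => e2.
by apply/eqP; rewrite -(eqn_add2r (\sum_(i in (M :\ v) :&: A) a i)) -e1 e2.
Qed.

End Graphs.

(** * Membership in monomial ideals *)

Section Ideals.
Import GRing.Theory.
Variables (n : nat) (k : fieldType).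
Implicit Types (p : {mpoly k[n]}) (g : seq {mpoly k[n]}) (s : seq 'X_{1..n}).

Local Open Scope ring_scope.

Lemma ideal_gen_0 g : ideal_gen g 0.
Proof. by exists (fun=> 0); rewrite big1 // => i _; rewrite mul0r. Qed.

Lemma ideal_gen_add g p q : ideal_gen g p -> ideal_gen g q -> ideal_gen g (p + q).
Proof.
move=> [a ->] [b ->]; exists (fun i => a i + b i).
by rewrite -big_split; apply: eq_bigr => i _; rewrite mulrDl.
Qed.

Lemma ideal_gen_mull g p q : q \in g -> ideal_gen g (p * q).
Proof.
move=> gq; have lt_q : (index q g < size g)%N by rewrite index_mem.
exists (fun i => if i == Ordinal lt_q then p else 0).
rewrite (bigD1 (Ordinal lt_q)) //= eqxx nth_index // big1 ?addr0 // => i /negPf->.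
by rewrite mul0r.
Qed.

(** Monomials of a multiple of a generator are divisible by it; conversely each term of [p] is a
    multiple of some generator. *)
Lemma monomial_idealP s p :
  monomial_ideal s p <-> {in msupp p, forall m, has (fun f => f <= m)%MM s}.
Proof.
split=> [[q ->] m /msupp_sum_le/flatten_mapP[i _]|supp_p].
  have lt_i : (i < size s)%N by rewrite -(size_map (@mpolyX n k) s).
  rewrite (nth_map 0%MM) // (perm_mem (msuppMX _ _)) => /mapP[m' _ ->].
  by apply/hasP; exists (nth 0%MM s i); rewrite ?mem_nth ?lem_addr.
rewrite [p]mpolyE big_seq; elim/big_rec: _ => [|m q m_p]; first exact: ideal_gen_0.
have /hasP[f sf le_fm] := supp_p m m_p.
apply: ideal_gen_add; rewrite -(submK le_fm) mpolyXD scalerAl.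
by apply: ideal_gen_mull; apply: map_f.
Qed.

Lemma monomial_idealX s m :
  monomial_ideal (k := k) s 'X_[m] <-> has (fun f => f <= m)%MM s.
Proof.
split=> [/monomial_idealP|s_m]; first by apply; rewrite msuppX inE.
by apply/monomial_idealP => m'; rewrite msuppX inE => /eqP->.
Qed.
End Ideals.

(** * Minimal generators of the cover ideal as minimal covers *)

Section Covers.
Variables (n : nat) (k : fieldType) (e : rel 'I_n).
Implicit Types (m f : 'X_{1..n}) (s : seq 'X_{1..n}).

(** The cover is the support of the exponent vector [m], which need not be squarefree. *)
Definition vcover m : Prop := forall i j, e i j -> (0 < m i) || (0 < m j).

Definition min_vcover m : Prop :=
  vcover m /\ forall f, vcover f -> (f <= m)%MM -> f = m.

Lemma cover_idealP (p : {mpoly k[n]}) :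
  cover_ideal k e p <-> {in msupp p, forall m, vcover m}.
Proof.
have eqE i j m : has (fun f => f <= m)%MM [:: U_(i); U_(j)]%MM = (0 < m i) || (0 < m j).
  by rewrite /= orbF !lep1mP !lt0n.
split=> [cov m pm i j /cov/(monomial_idealP [:: U_(i); U_(j)]%MM)/(_ m pm)|cov i j eij].
  by rewrite eqE.
apply/(monomial_idealP [:: U_(i); U_(j)]%MM) => m /cov/(_ i j eij).
by rewrite eqE.
Qed.

Lemma cover_idealX m : cover_ideal k e 'X_[m] <-> vcover m.
Proof.
split=> [/cover_idealP|cov]; first by apply; rewrite msuppX inE.
by apply/cover_idealP => m'; rewrite msuppX inE => /eqP->.
Qed.

(** Every cover is divisible by a generator, so a minimal cover is one; and no generator properly
    divides another, as the larger would be redundant. *)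
Lemma mem_minimal_generators s :
  minimal_generators s (cover_ideal k e) -> forall m, m \in s <-> min_vcover m.
Proof.
case=> Us gen_s min_s.
have covE m : vcover m <-> has (fun f => f <= m)%MM s.
  by rewrite -cover_idealX -gen_s monomial_idealX.
move=> m; split=> [sm|[/covE/hasP[f sf le_fm] min_m]]; last first.
  by rewrite -(min_m f) //; apply/covE/hasP; exists f; rewrite ?lepm_refl.
split=> [|h /covE/hasP[f sf le_fh] le_hm].
  by apply/covE/hasP; exists m; rewrite ?lepm_refl.
have le_fm := lepm_trans le_fh le_hm.
suff ef : f = m.
  by apply/mnmP => i; apply/eqP; rewrite eqn_leq (mnm_lepP le_hm) -ef (mnm_lepP le_fh).
apply/eqP; apply: contraT => nfm.
(* If [f] differs from [m], it stands in for [m], so [rem m s] still generates. *)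
have: m \in rem m s; last by rewrite mem_rem_uniqF.
apply: min_s sm => [x /mem_rem//|p].
rewrite -gen_s !monomial_idealP; split=> gen_p x px; apply/hasP; have /hasP[y + yx] := gen_p x px.
  by move=> /mem_rem sy; exists y.
have [eym|ym sy] := eqVneq y m; last by exists y; rewrite // mem_rem_uniq // inE ym.
by exists f; rewrite ?mem_rem_uniq ?inE ?nfm // -?eym // (lepm_trans le_fm) -?eym.
Qed.

(** A sublist that still generates contains a divisor of each [m] in [s], which minimality of [m]
    forces to be [m] itself. *)
Lemma minimal_generators_min_vcover s :
  uniq s -> {in s, forall m, min_vcover m} ->
  (forall m, vcover m -> has (fun f => f <= m)%MM s) ->
  minimal_generators s (cover_ideal k e).
Proof.
move=> Us min_s ex_s; split=> // [p|s' s's gen_s' m sm].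
  rewrite monomial_idealP cover_idealP; split=> gen_p m /gen_p; last exact: ex_s.
  case/hasP=> f /min_s[cov_f _] /mnm_lepP le_fm i j /cov_f.
  by case/orP=> h; apply/orP; [left|right]; apply: leq_trans h _.
have [cov_m min_m] := min_s m sm.
have /hasP[f s'f le_fm] : has (fun f => f <= m)%MM s'.
  by apply/(monomial_idealX k); apply/gen_s'/cover_idealX.
by rewrite -(min_m f) //; have [] := min_s f (s's f s'f).
Qed.

End Covers.

(** * Covers as complements of independent sets, and the leaf weight *)

Section CoverWeights.
Variables (n : nat) (e : rel 'I_n).
Hypotheses (e_sym : ssrbool.symmetric e) (e_irr : irreflexive e).
Implicit Types (m f : 'X_{1..n}) (M : {set 'I_n}) (a : 'I_n -> nat).

Definition compl_mnm M : 'X_{1..n} := [multinom (i \notin M : nat) | i < n].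

Lemma compl_mnmE M i : compl_mnm M i = (i \notin M).
Proof. by rewrite mnmE. Qed.

(** Independence gives the cover. A cover below it vanishes on [M], so domination makes it positive
    off [M]. *)
Lemma max_indep_min_vcover M : maxset (indep e) M -> min_vcover e (compl_mnm M).
Proof.
case/(max_indepP e_sym e_irr) => /indepP iM domM; split=> [i j eij|f cov_f le_f].
  rewrite !compl_mnmE !lt0b -negb_and; apply/negP => /andP[iM' jM].
  by rewrite (negPf (iM i j iM' jM)) in eij.
apply/mnmP => i; apply/eqP; rewrite eqn_leq (mnm_lepP le_f) compl_mnmE.
case: (boolP (i \in M)) => //= /domM[y yM /cov_f].
by have := mnm_lepP le_f y; rewrite compl_mnmE yM leqn0 => /eqP->; rewrite orbF.
Qed.

(** The zero set of a cover is independent; extend it to a maximal independent set. *)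
Lemma vcover_compl m :
  vcover e m -> exists2 M, maxset (indep e) M & (compl_mnm M <= m)%MM.
Proof.
move=> cov_m; have ind_m : indep e [set i | m i == 0].
  apply/indepP => x y; rewrite !inE => /eqP mx /eqP my; apply/negP => /cov_m.
  by rewrite mx my.
have [M maxM /subsetP mM] := max_indep_exists ind_m; exists M => //.
apply/mnm_lepP => i; rewrite compl_mnmE; case: (boolP (i \in M)) => // iM.
by rewrite lt0n; apply: contra iM => mi; apply: mM; rewrite inE.
Qed.

Lemma cover_ideal_minimal_generators (k : fieldType) :
  exists s, minimal_generators s (cover_ideal k e).
Proof.
exists [seq compl_mnm M | M <- enum [set M | maxset (indep e) M]].
apply: minimal_generators_min_vcover => [|m|m /vcover_compl[M maxM le_Mm]].
- rewrite map_inj_uniq ?enum_uniq // => M N /mnmP eqMN; apply/setP => i.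
  by have := eqMN i; rewrite !compl_mnmE => /(congr1 odd); rewrite !oddb => /negb_inj.
- by case/mapP => M; rewrite mem_enum inE => maxM ->; apply: max_indep_min_vcover.
by apply/hasP; exists (compl_mnm M); rewrite // map_f // mem_enum inE.
Qed.

Lemma wdeg_compl_mnm a M : wdeg a (compl_mnm M) + \sum_(i in M) a i = \sum_i a i.
Proof.
rewrite /wdeg [RHS](bigID (mem M)) /= addnC; congr (_ + _).
rewrite [RHS]big_mkcond; apply: eq_bigr => i _; rewrite compl_mnmE.
by case: (i \in M); rewrite ?muln0 ?muln1.
Qed.

(** Truncating all exponents at 1 leaves a cover. *)
Lemma min_vcover_le1 m i : min_vcover e m -> m i <= 1.
Proof.
case=> cov_m min_m; rewrite -(min_m [multinom minn (m j) 1 | j < n]).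
- by rewrite mnmE geq_minr.
- by move=> x y /cov_m; rewrite !mnmE !leq_min !andbT.
- by apply/mnm_lepP => j; rewrite mnmE geq_minl.
Qed.

(** Otherwise setting the exponent at [i] to 0 would leave a cover. *)
Lemma min_vcover_private m i :
  min_vcover e m -> 0 < m i -> exists2 j, e i j & m j = 0.
Proof.
case=> cov_m min_m mi; apply/exists_eq_inP; apply: contraT.
rewrite negb_exists => /forallP m_nbr.
have nbr j : e i j -> 0 < m j by move=> eij; have := m_nbr j; rewrite eij lt0n.
have := mi; rewrite -(min_m [multinom if j == i then 0 else m j | j < n]).
- by rewrite mnmE eqxx.
- move=> x y exy; rewrite !mnmE; have [xi|_] := eqVneq x i.
    have [yi|_] := eqVneq y i; first by rewrite xi yi e_irr in exy.
    by apply: nbr; rewrite -xi.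
  have [yi|_] := eqVneq y i; last exact: cov_m.
  by rewrite orbF; apply: nbr; rewrite e_sym -yi.
- by apply/mnm_lepP => j; rewrite mnmE; case: ifP.
Qed.

(** The sum is the exponent at the only neighbour of [l]. Covering makes one end positive, and if
    [l] is in the cover, its private neighbour can only be that one. *)
Lemma min_vcover_leaf m l : min_vcover e m -> leaf e l ->
  m l + \sum_(i < n) e l i * m i = 1.
Proof.
move=> min_m /cards1P[p /setP def_p].
have lE i : e l i = (i == p) by have := def_p i; rewrite !inE.
rewrite (bigD1 p) //= lE eqxx mul1n big1 ?addn0 => [|i /negPf ip]; last first.
  by rewrite lE ip.
have := min_m.1 l p; rewrite lE eqxx => /(_ isT).
have := min_vcover_le1 l min_m; have := min_vcover_le1 p min_m.
case: (posnP (m l)) => [->|ml]; first by case: (m p) => [|[]].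
have [j] := min_vcover_private min_m ml; rewrite lE => /eqP-> ->.
by move: ml; case: (m l) => [|[]].
Qed.

(* Number of edges at [i] with a leaf end, an edge between two leaves counting
   twice; isolated vertices, which no minimal cover contains, get weight 1. *)
Definition leaf_weight (i : 'I_n) : nat :=
  (degree e i == 0) + \sum_(l < n | leaf e l) ((i == l) + e l i).

(** Double counting: after exchanging the sums, each leaf contributes the exponents at the two ends
    of its edge, which add up to 1. *)
Lemma wdeg_leaf_weight m : min_vcover e m ->
  wdeg leaf_weight m = \sum_(l < n | leaf e l) 1.
Proof.
move=> min_m; transitivity
    (\sum_(i < n) \sum_(l < n | leaf e l) ((i == l) + e l i) * m i).
  apply: eq_bigr => i _; rewrite -big_distrl /= mulnDl.
  suff ->: (degree e i == 0) * m i = 0 by [].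
  case: (posnP (m i)) => [->|]; first by rewrite muln0.
  case/(min_vcover_private min_m) => j eij _; case: eqP => // /eqP.
  by rewrite cards_eq0 => /eqP/setP/(_ j); rewrite !inE eij.
rewrite exchange_big /=; apply: eq_bigr => l leaf_l.
rewrite -(min_vcover_leaf min_m leaf_l) -[in RHS](big_pred1_eq addn l m).
rewrite [in RHS]big_mkcond -big_split; apply: eq_bigr => i _ /=.
by rewrite mulnDl; case: (i == l); rewrite ?mul1n.
Qed.

Lemma leaf_weight_gt0 :
  (forall v, 2 <= degree e v -> exists w, e v w /\ leaf e w) ->
  forall i, 0 < leaf_weight i.
Proof.
move=> leaf_nbr i; rewrite /leaf_weight addn_gt0 lt0b.
(* Positivity comes from a leaf neighbour, from the isolated-vertex term, or from [i] being itself a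
   leaf. *)
case: (ltngtP 1 (degree e i)) => [/leaf_nbr[l [eil leaf_l]]|d0|d1].
- by rewrite (bigD1 l) //= (e_sym l) eil addn_gt0 addn_gt0 orbT orbT.
- by move: d0; case: (degree e i).
- by rewrite (bigD1 i) ?eqxx ?orbT //= /leaf -d1.
Qed.

End CoverWeights.

Theorem theorem3p8 (k : fieldType) (n : nat) (e : rel 'I_n)
  (e_sym : ssrbool.symmetric e) (e_irr : irreflexive e) (e_tree : tree e) :
  quasi_equigenerated (cover_ideal k e) <->
  (forall v : 'I_n, (2 <= degree e v)%N -> exists w : 'I_n, e v w /\ leaf e w).
Proof.
split=> [[s [gen_s [a [a_gt0 wt_eq]]]] v|leaf_nbr].
  apply: (tree_constant_weight_leaf e_sym e_irr e_tree a_gt0) => M N maxM maxN.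
  have memE := mem_minimal_generators gen_s.
  have sM : compl_mnm M \in s by apply/memE/max_indep_min_vcover.
  have sN : compl_mnm N \in s by apply/memE/max_indep_min_vcover.
  have := wdeg_compl_mnm a M; rewrite -(wdeg_compl_mnm a N) (wt_eq _ _ sM sN).
  exact: addnI.
have [s gen_s] := cover_ideal_minimal_generators e_sym e_irr k.
exists s; split=> //; exists (leaf_weight e).
split=> [|f g /(mem_minimal_generators gen_s) min_f /(mem_minimal_generators gen_s) min_g].
  exact: leaf_weight_gt0.
by rewrite !wdeg_leaf_weight.
Qed.
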